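(* Let $\mathcal T$ be a theory (over a signature of arbitrary arity) each of whose existential TGDs has the form $\Psi(\bar x,y)\Rightarrow\exists\bar z\,\Phi(y,\bar z)$, where $\Psi$ is a conjunctive query and $\Phi(y,\bar z)$ is an atom whose variables are among $y$ and the existentially quantified $\bar z$. If $\mathcal T$ is BDD, then $\mathcal T$ is FC.
   Context: A theory is a finite set of such existential TGDs and plain datalog rules $\forall\bar x(\Phi(\bar x)\Rightarrow Q(\bar y))$, $\bar y\subseteq\bar x$, with $\Phi$ a conjunction of atoms. A database instance is a finite set of ground atoms; queries are Boolean conjunctive queries. $\mathcal T,D\models\Phi$ means every model of $D$ and $\mathcal T$ satisfies $\Phi$. BDD: for every conjunctive query $\Phi$ there is a finite union of conjunctive queries $\Phi'$ with $\mathcal T,D\models\Phi$ iff $D\models\Phi'$ for every database instance $D$. FC: for every database instance $D$ and query $\Phi$ with $\mathcal T,D\not\models\Phi$ there exists a finite structure satisfying $D$ and $\mathcal T$ but not $\Phi$. *)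

(* Defs.v *)
From Stdlib Require Import List.
Import ListNotations.
Set Implicit Arguments.

Section Rules.
Variable P : Type.
Variable arity : P -> nat.

Definition atom (T : Type) := (P * list T)%type.
Definition wf_atom (T : Type) (a : atom T) : Prop := length (snd a) = arity (fst a).

Definition var := nat.
Definition const := nat.

(* A conjunctive query / conjunction of atoms over variables.
   As a Boolean CQ all its variables are existentially quantified. *)
Definition cq := list (atom var).
Definition ucq := list cq.
Definition wf_cq (q : cq) : Prop := forall a, In a q -> wf_atom a.

Definition vars (q : cq) : list var := flat_map (@snd _ _) q.

(* A rule forall x (body(x) -> exists z head(y,z)); variables of the head
   not occurring in the body are existentially quantified. *)
Record rule := Rule { body : cq; head : cq }.
Definition wf_rule (r : rule) := wf_cq (body r) /\ wf_cq (head r).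

Definition datalog_rule (r : rule) : Prop :=
  exists a, head r = [a] /\ forall v, In v (snd a) -> In v (vars (body r)).

Definition theory := list rule.
Definition wf_theory (T : theory) := forall r, In r T -> wf_rule r.

Definition database := list (atom const).
Definition wf_db (D : database) := forall f, In f D -> wf_atom f.
Definition adom (D : database) : list const := flat_map (@snd _ _) D.

Record structure := Struct {
  dom : Type;
  elt : dom;
  rel : P -> list dom -> Prop }.

Definition holds {M : structure} (nu : var -> dom M) (a : atom var) : Prop :=
  rel M (fst a) (map nu (snd a)).

Definition sat_cq (M : structure) (q : cq) : Prop :=
  exists nu : var -> dom M, forall a, In a q -> holds (M:=M) nu a.

Definition sat_ucq (M : structure) (Q : ucq) : Prop :=
  exists q, In q Q /\ sat_cq M q.

Definition sat_rule (M : structure) (r : rule) : Prop :=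
  forall nu : var -> dom M, (forall a, In a (body r) -> holds (M:=M) nu a) ->
    exists nu' : var -> dom M,
      (forall v, In v (vars (body r)) -> nu' v = nu v) /\
      (forall a, In a (head r) -> holds (M:=M) nu' a).

Definition model_theory (M : structure) (T : theory) : Prop :=
  forall r, In r T -> sat_rule M r.

Definition model_db (M : structure) (D : database) : Prop :=
  exists h : const -> dom M,
    (forall c d, In c (adom D) -> In d (adom D) -> h c = h d -> c = d) /\
    (forall f, In f D -> rel M (fst f) (map h (snd f))).

Definition finite_structure (M : structure) : Prop :=
  exists l : list (dom M), forall x, In x l.

Definition entails (T : theory) (D : database) (q : cq) : Prop :=
  forall M : structure, model_db M D -> model_theory M T -> sat_cq M q.

Definition db_structure (D : database) : structure :=
  {| dom := const; elt := 0; rel := fun p l => In (p, l) D |}.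

Definition BDD (T : theory) : Prop :=
  forall q : cq, wf_cq q ->
    exists Q : ucq, (forall q', In q' Q -> wf_cq q') /\
      forall D : database, wf_db D ->
        (entails T D q <-> sat_ucq (db_structure D) Q).

Definition FC (T : theory) : Prop :=
  forall (D : database) (q : cq), wf_db D -> wf_cq q ->
    ~ entails T D q ->
    exists M : structure, finite_structure M /\ model_db M D /\
      model_theory M T /\ ~ sat_cq M q.

Definition single_frontier_atom_tgd (r : rule) : Prop :=
  exists a y, head r = [a] /\
    forall v, In v (snd a) -> In v (vars (body r)) -> v = y.

End Rules.

(* Main.v *)
(* Let [Q] be the rewriting of the query [q].  Hang a forest of Skolem terms on
   the database, a set [F] of triggers telling at which terms the head of which
   rule is added, whether or not the body holds there.  By Zorn's lemma take [F]
   maximal among the ancestor-closed sets whose forest does not satisfy [Q].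
   Identify terms of equal depth modulo [K + 1] that cannot be told apart by
   looking [K] steps up the term and then at the firings [K] steps below, where
   [K] bounds the number of variables in a disjunct of [Q].  The finite quotient
   still refutes [Q], hence, being a database, it does not entail [q].  Its
   closure under the datalog rules is the required model: if the body of an
   existential rule became derivable at the class of a term where the rule is
   not fired, then every model of the theory and the quotient would receive a
   homomorphism from the forest with that firing added, hence by maximality
   would satisfy [Q] and therefore [q]. *)
From mathcomp Require Import all_boot.
From mathcomp Require Import zify.
From mathcomp Require Import boolp classical_sets.
From Stdlib Require Import List.
Require Import Defs.

Set Implicit Arguments.
Unset Strict Implicit.
Unset Printing Implicit Defensive.

Local Open Scope classical_set_scope.

Lemma In_mem (T : eqType) (x : T) (s : list T) : reflect (In x s) (x \in s).
Proof.
elim: s => [|y s IH] /=; first by constructor.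
rewrite inE; apply: (iffP orP) => [[/eqP->|/IH]|[->|/IH]]; by auto.
Qed.

Lemma list_upper_bound (s : list nat) : exists n, forall x, In x s -> x < n.+1.
Proof.
elim: s => [|y s [n IH]]; first by exists 0.
exists (maxn y n) => x /= [<-|/IH]; rewrite !ltnS ?leq_maxl // => xn.
exact: leq_trans xn (leq_maxr _ _).
Qed.

(** * Conjunctive queries: homomorphisms and rewritings *)

Section ConjunctiveQueries.
Variables (P : Type) (arity : P -> nat).
Implicit Types (T : theory P) (q : cq P) (Q : ucq P).

Lemma In_vars q a v : In a q -> In v (snd a) -> In v (vars q).
Proof. by move=> aq va; apply/in_flat_map; exists a. Qed.

Lemma sat_cq_hom (M N : structure P) (f : dom M -> dom N) q :
  (forall p l, rel M p l -> rel N p (List.map f l)) -> sat_cq M q -> sat_cq N q.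
Proof.
move=> fhom [nu nuP]; exists (fun v => f (nu v)) => a /nuP /fhom.
by rewrite List.map_map.
Qed.

Lemma sat_ucq_hom (M N : structure P) (f : dom M -> dom N) Q :
  (forall p l, rel M p l -> rel N p (List.map f l)) ->
  sat_ucq M Q -> sat_ucq N Q.
Proof.
by move=> fhom [q [qQ qM]]; exists q; split=> //; exact: sat_cq_hom fhom qM.
Qed.

(* The image of the disjunct in [M] is the database to which the rewriting is
   applied: freezing the disjunct itself would not give an injective [h]. *)
Lemma rewriting_sound T q Q (M : structure P) :
  (forall q', In q' Q -> wf_cq arity q') ->
  (forall E, wf_db arity E -> sat_ucq (db_structure E) Q -> entails T E q) ->
  model_theory M T -> sat_ucq M Q -> sat_cq M q.
Proof.
move=> Qwf Qrew MT [q' [q'Q [nu nuP]]].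
pose repr v : nat := xget 0 [set w : nat | nu w = nu v].
have nu_repr v : nu (repr v) = nu v.
  by apply: (@xgetPex _ 0 [set w : nat | nu w = nu v]); exists v.
pose E : database P := List.map (fun a => (fst a, List.map repr (snd a))) q'.
have Ewf : wf_db arity E.
  move=> f /in_map_iff [a [<- aq']]; rewrite /wf_atom /= length_map.
  exact: Qwf q'Q a aq'.
apply: (Qrew E) => //.
- exists q'; split=> //; exists repr => a aq'.
  by apply/in_map_iff; exists a.
- have adomE c : In c (adom E) -> exists v, c = repr v.
    move=> /in_flat_map [f [/in_map_iff [a [<- _]] /in_map_iff [v [<- _]]]].
    by exists v.
  exists nu; split=> [c d /adomE [v ->] /adomE [w ->]|f].
    by rewrite !nu_repr /repr => ->.
  move=> /in_map_iff [a [<- /nuP aM]] /=; rewrite List.map_map.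
  by rewrite (List.map_ext _ nu).
Qed.

End ConjunctiveQueries.

(** * Skolem forests and a maximal set of triggers *)

Section SkolemForest.
Variables (P : Type) (T : theory P) (D : database P) (B V : nat).

Definition index := 'I_(length T).
Definition sym := (index * 'I_V.+1)%type.
Definition root := ('I_B.+1 + sym)%type.
(* The node [(c, w)] is the Skolem term over the root [c] whose symbols,
   outermost first, are [w]; roots in [sym] are Skolem constants. *)
Definition node := (root * seq.seq sym)%type.
Definition trigger := (option node * index)%type.

Implicit Types (i j : index) (k : option node) (x : node).
Implicit Types (F G : set trigger).

Definition rule_of i := List.nth i T (Rule nil nil).

(** For an existential rule with a frontier this is its only frontier variable. Datalog rules may be
    fired too; every head variable but the first then becomes a Skolem term, which weakens the
    rule. *)
Definition frontier i : option var :=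
  ohead [seq v <- vars (head (rule_of i)) | v \in vars (body (rule_of i))].

Definition cst (c : const) : node := (inl (inord c), [::]).

Definition skolem k i (v : var) : node :=
  if k is Some x then
    if frontier i == Some v then x else (x.1, (i, inord v) :: x.2)
  else (inr (i, inord v), [::]).

(** The only trigger that can create the node; database constants have none. *)
Definition origin x : option trigger :=
  match x with
  | (inl _, [::]) => None
  | (inr s, [::]) => Some (None, s.1)
  | (c, s :: w) => Some (Some (c, w), s.1)
  end.

Definition last_var x : var :=
  match x with
  | (inl _, [::]) => 0
  | (inr s, [::]) => s.2
  | (_, s :: _) => s.2
  end.

Inductive fact F : P -> list node -> Prop :=
| fact_db p l : In (p, l) D -> fact F p (List.map cst l)
| fact_fire k i a : F (k, i) -> In a (head (rule_of i)) ->
    fact F (fst a) (List.map (skolem k i) (snd a)).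

Definition forest F : structure P :=
  {| dom := node; elt := cst 0; rel := fact F |}.

Definition alive F x := if origin x is Some e then F e else True.

(** Ancestor closure. The place [None] is reserved for rules without a frontier. *)
Definition closed F :=
  forall k i, F (k, i) ->
    isSome k = isSome (frontier i) /\ (if k is Some x then alive F x else True).

Lemma frontier_Some i y : frontier i = Some y ->
  In y (vars (body (rule_of i))) /\ In y (vars (head (rule_of i))).
Proof.
rewrite /frontier => h.
have : y \in [seq v <- vars (head (rule_of i)) | v \in vars (body (rule_of i))].
  by case: [seq _ <- _ | _] h => //= z s [->]; rewrite inE eqxx.
by rewrite mem_filter => /andP [/In_mem ? /In_mem ?].
Qed.

Lemma frontier_None i v : frontier i = None ->
  In v (vars (head (rule_of i))) -> ~ In v (vars (body (rule_of i))).
Proof.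
rewrite /frontier => h /In_mem vh /In_mem vb.
have : v \in [seq v <- vars (head (rule_of i)) | v \in vars (body (rule_of i))].
  by rewrite mem_filter vb.
by case: [seq _ <- _ | _] h.
Qed.

Lemma skolem_origin k i v : isSome k = isSome (frontier i) ->
  frontier i <> Some v -> origin (skolem k i v) = Some (k, i).
Proof.
by case: k => [[c w]|] //= _ /eqP/negbTE ->; case: c.
Qed.

Lemma skolem_last_var k i v : v < V.+1 ->
  frontier i <> Some v -> last_var (skolem k i v) = v.
Proof.
move=> vV; case: k => [[c w]|] /=; last by rewrite inordK.
by move=> /eqP/negbTE -> /=; case: c; rewrite /= inordK.
Qed.

Lemma skolem_frontier x i v : frontier i = Some v -> skolem (Some x) i v = x.
Proof. by rewrite /skolem => /eqP ->. Qed.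

Lemma alive_skolem F k i v : closed F -> F (k, i) -> alive F (skolem k i v).
Proof.
move=> Fcl Fki; have [ki kF] := Fcl _ _ Fki.
have [fv|/eqP fv] := eqVneq (frontier i) (Some v).
  by case: k Fki ki kF => [x|]; rewrite fv // skolem_frontier.
by rewrite /alive skolem_origin.
Qed.

Lemma fact_alive F p l x : closed F -> fact F p l -> In x l -> alive F x.
Proof.
move=> Fcl [p' l' _|k i a Fki ah] /in_map_iff [v [<- _]] //.
exact: alive_skolem.
Qed.

Lemma fact_sub F G p l : F `<=` G -> fact F p l -> fact G p l.
Proof.
by move=> FG [p' l' plD|k i a /FG Gki ah]; [apply: fact_db|apply: fact_fire].
Qed.

Lemma closed_setU1 F k i : closed F -> isSome k = isSome (frontier i) ->
  (if k is Some x then alive F x else True) -> closed (F `|` [set (k, i)]).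
Proof.
have aliveU x : alive F x -> alive (F `|` [set (k, i)]) x.
  by rewrite /alive; case: origin => // e; left.
move=> Fcl ki kF k' i' [/Fcl [k'i' k'F]|[-> ->]]; split=> //.
  by case: k' k'F {k'i'} => // x; apply: aliveU.
by case: k kF {ki} aliveU => // x ? aliveU; apply: aliveU.
Qed.

Lemma closed_bigcup (C : set (set trigger)) :
  (forall F, C F -> closed F) -> closed (\bigcup_(F in C) F).
Proof.
move=> Ccl k i [F CF Fki]; have [ki kF] := Ccl _ CF _ _ Fki; split=> //.
case: k kF {ki Fki} => // x; rewrite /alive; case: origin => // e Fe.
by exists F.
Qed.

(** A query uses finitely many facts, each needing at most one trigger, so some member of the chain
    supplies them all. *)
Lemma forest_bigcup (C : set (set trigger)) (q : cq P) (nu : var -> node) :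
  C !=set0 -> total_on C subset ->
  (forall a, In a q -> holds (M := forest (\bigcup_(F in C) F)) nu a) ->
  exists2 F, C F & forall a, In a q -> holds (M := forest F) nu a.
Proof.
move=> C0 Ctot; elim: q => [|a q IH] qU; first by case: C0 => F; exists F.
have [F CF qF] := IH (fun b bq => qU b (or_intror bq)).
have [G CG aG] : exists2 G, C G & holds (M := forest G) nu a.
  have := qU a (or_introl erefl); rewrite /holds /=.
  case=> [p l plD|k i b [G CG Gki] bh].
    by exists F => //; apply: fact_db.
  by exists G => //; apply: fact_fire.
have [FG|GF] := Ctot _ _ CF CG.
  exists G => // b [<- //|/qF]; exact: fact_sub.
exists F => // b [<-|/qF //]; exact: fact_sub aG.
Qed.

Lemma maximal_forest (Q : ucq P) :
  (forall c, In c (adom D) -> c < B.+1) -> ~ sat_ucq (db_structure D) Q ->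
  exists F, [/\ closed F, ~ sat_ucq (forest F) Q &
    forall G, F `<` G -> closed G -> sat_ucq (forest G) Q].
Proof.
move=> DB DQ.
have [|F [[Fcl FQ] Fmax]] :=
    @Zorn_bigcup _ (fun F => closed F /\ ~ sat_ucq (forest F) Q).
  move=> C CP Ctot; split; first by apply: closed_bigcup => F /CP [].
  (* The union of the empty chain is empty; its forest is a copy of the database, where [Q] fails by
     assumption. *)
  have [C0|C0] := pselect (C !=set0); last first.
    apply: contra_not DQ.
    pose decode x : const := if x.1 is inl c then c : nat else 0.
    apply: (@sat_ucq_hom _ (forest _) (db_structure D) decode).
    move=> p l [p' l' plD|k i a [F CF _] _]; last by case: C0; exists F.
    rewrite /= List.map_map (List.map_ext_in _ id) ?List.map_id // => c cl.
    by rewrite /decode /= inordK //; apply: DB; apply/in_flat_map;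
      exists (p', l').
  move=> [q [qQ [nu nuP]]]; have [F CF FP] := forest_bigcup C0 Ctot nuP.
  by have [_ []] := CP _ CF; exists q; split=> //; exists nu.
by exists F; split=> // G FG Gcl; apply: contrapT => GQ; apply: (Fmax G).
Qed.


(** * The finite quotient of the forest *)

Variable K : nat.
Implicit Type r : 'I_K.+1.

(** As [K - r] is congruent to [-(r + 1)] modulo [K + 1], this is the distance up to the nearest
    ancestor of depth congruent to [r + 1]. The forest is thus cut just below the levels of residue
    [r]. Near the root the climb may overshoot, and then ends at the root. *)
Definition climb (r : 'I_K.+1) x := (size x.2 + (K - r)) %% K.+1.

Definition ancestor n x : node := (x.1, drop n x.2).

Definition fires_below := {ffun K.-bseq sym * index -> bool}.
(** The root is recorded only at roots, so that distinct roots are never identified. *)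
Definition type := (option root * fires_below)%type.

Definition type_of F x : type :=
  (if x.2 is [::] then Some x.1 else None,
   [ffun p : K.-bseq sym * index => `[< F (Some (x.1, cat p.1 x.2), p.2) >]]).

Definition type_repr F (t : type) : node :=
  xget (cst 0) [set x | type_of F x = t].

(** Stores what [unfold] reads for every [r] at once, since the residue to be avoided depends on the
    query match. *)
Definition class := ('I_K.+1 * {ffun 'I_K.+1 -> K.-bseq sym * type})%type.

Definition class_of F x : class :=
  (inord (size x.2 %% K.+1),
   [ffun r => (insub_bseq K (take (climb r x) x.2),
               type_of F (ancestor (climb r x) x))]).

(** Moves the piece of the forest between two cuts onto the chosen representative of the type at its
    top. *)
Definition unfold F r x : node :=
  let y := type_repr F (type_of F (ancestor (climb r x) x)) in
  (y.1, cat (take (climb r x) x.2) y.2).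

Definition quotient F : structure P :=
  {| dom := class; elt := class_of F (cst 0);
     rel := fun p l => exists2 l', fact F p l' & l = List.map (class_of F) l' |}.

Lemma climb_le r x : climb r x <= K.
Proof. by rewrite -ltnS ltn_pmod. Qed.

Lemma type_reprK F x : type_of F (type_repr F (type_of F x)) = type_of F x.
Proof.
by apply: (@xgetPex _ _ [set y | type_of F y = type_of F x]); exists x.
Qed.

Lemma type_repr_root F c : type_repr F (type_of F (c, [::])) = (c, [::]).
Proof.
have := type_reprK F (c, [::]); case: type_repr => d [|s w] /=.
  by move=> [-> _].
by move=> [].
Qed.

Lemma unfold_root F r c : unfold F r (c, [::]) = (c, [::]).
Proof. by rewrite /unfold /ancestor /= type_repr_root. Qed.

(** Off residue [r] no cut separates a node from its child, so both climb to the same ancestor. *)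
Lemma unfold_push F r c s w : size w %% K.+1 <> r ->
  unfold F r (c, s :: w) =
    ((unfold F r (c, w)).1, s :: (unfold F r (c, w)).2).
Proof.
move=> rw; have climbS : climb r (c, s :: w) = (climb r (c, w)).+1.
  rewrite /climb /= addSn modnS; case: ifP => // /dvdnP [m mE].
  case: rw; have rK : r <= K by rewrite -ltnS.
  case: m mE => [//|m]; rewrite mulSn => mE.
  have -> : size w = (m * K.+1 + r)%N by lia.
  by rewrite modnMDl modn_small.
by rewrite /unfold climbS /ancestor.
Qed.

(** The word from the ancestor down to [x] has length at most [K], so the type of the ancestor
    records this firing and its representative shares it. *)
Lemma unfold_fires F r x i : F (Some x, i) -> F (Some (unfold F r x), i).
Proof.
case: x => c w Fxi; rewrite /unfold /=.
set n := climb _ _; set t := type_of F _.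
have := type_reprK F (ancestor n (c, w)); rewrite -/t.
case: type_repr => d u; rewrite /t => -[_ /ffunP tE] /=.
have sz : size (take n w) <= K.
  by rewrite (leq_trans _ (climb_le r (c, w))) // size_take_min geq_minl.
have := tE (Bseq sz, i); rewrite !ffunE /= cat_take_drop => /asboolP.
by rewrite asboolT // => /asboolP.
Qed.

Lemma unfold_class F r x y : class_of F x = class_of F y ->
  unfold F r x = unfold F r y.
Proof.
move=> /(congr1 (fun c : class => c.2 r)); rewrite !ffunE => xyE.
have /(congr1 val) := congr1 fst xyE; have /= := congr1 snd xyE.
have sz z : size (take (climb r z) z.2) <= K.
  by rewrite (leq_trans _ (climb_le r z)) // size_take_min geq_minl.
by rewrite /unfold => ->; rewrite !insubdK; [move=> /= -> | exact: sz ..].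
Qed.

Lemma class_of_cst F c d : class_of F (cst c) = class_of F (cst d) ->
  cst c = cst d.
Proof. by move=> /(unfold_class ord0); rewrite !unfold_root. Qed.

Lemma class_residue F x : ((class_of F x).1 : nat) = size x.2 %% K.+1.
Proof. by rewrite /= inordK // ltn_pmod. Qed.

(** Only a firing across a cut could be broken. The single head atom contains the frontier variable,
    so the fact would have the firing node, of residue [r], among its arguments. *)
Lemma unfold_fact F r p l :
  (forall i, exists a, head (rule_of i) = [:: a]) -> closed F -> fact F p l ->
  (forall x, In x l -> size x.2 %% K.+1 <> r) ->
  fact F p (List.map (unfold F r) l).
Proof.
move=> single Fcl [p' l' plD|k i a Fki ah] rl; rewrite List.map_map.
  rewrite (List.map_ext _ cst); first exact: fact_db.
  by move=> c; apply: unfold_root.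
have [ki _] := Fcl _ _ Fki.
case: k ki Fki rl => [x|] ki Fki rl; last first.
  rewrite (List.map_ext _ (skolem None i)); first exact: fact_fire.
  by move=> v; apply: unfold_root.
rewrite (List.map_ext_in _ (skolem (Some (unfold F r x)) i)).
  by apply: fact_fire ah; apply: unfold_fires.
move=> v _; rewrite /skolem; case: ifP => // _.
case: x {Fki} ki rl => c w ki rl; rewrite unfold_push //.
case fi: (frontier i) ki => [y|] // _.
have [_ yh] := frontier_Some fi.
have ya : In y (snd a).
  have [b hb] := single i; move: ah yh; rewrite hb /vars /= app_nil_r.
  by case=> [<-|].
apply: (rl (c, w)); apply/in_map_iff; exists y; split=> //.
exact: skolem_frontier.
Qed.

(* A disjunct with at most [K] variables avoids one of the [K + 1] depth
   residues, and [unfold] is a homomorphism off the nodes of that residue. *)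
Lemma quotient_conservative F (Q : ucq P) :
  (forall i, exists a, head (rule_of i) = [:: a]) -> closed F ->
  (forall q, In q Q -> length (vars q) <= K) ->
  sat_ucq (quotient F) Q -> sat_ucq (forest F) Q.
Proof.
move=> single Fcl QK [q [qQ [nu nuP]]]; exists q; split=> //.
have [r rq] : exists r : 'I_K.+1, r \notin [seq (nu v).1 | v <- vars q].
  apply: contrapT => /forallNP all_r.
  have : #|'I_K.+1| <= length (vars q).
    rewrite -[length _]/(size _) -(size_map (fun v => (nu v).1)).
    apply: leq_trans (card_size _); apply: subset_leq_card.
    apply/fintype.subsetP => r _.
    by have /negP/negPn := all_r r.
  by rewrite card_ord; move/(leq_trans)/(_ (QK _ qQ)); rewrite ltnn.
(* Any node of the class will do, since [unfold F r] is constant on classes. *)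
pose node_of (c : class) := xget (cst 0) [set x | class_of F x = c].
have node_ofK x : class_of F (node_of (class_of F x)) = class_of F x.
  by apply: (@xgetPex _ _ [set y | class_of F y = class_of F x]); exists x.
exists (fun v => unfold F r (node_of (nu v))) => a aq.
have [l al lE] := nuP _ aq; rewrite /holds /= -List.map_map -List.map_map lE.
rewrite !List.map_map (List.map_ext _ (unfold F r)); last first.
  by move=> x; apply/unfold_class/node_ofK.
apply: unfold_fact => // x xl xr; move/negP: rq; apply; apply/mapP.
have /in_map_iff [v [vx va]] : In (class_of F x) (List.map nu (snd a)).
  by rewrite lE; apply: in_map.
exists v; first by apply/In_mem/(In_vars aq).
by apply: val_inj; rewrite vx;
  apply: etrans (esym xr) (esym (class_residue _ _)).
Qed.

(** Bounds the predicates and lengths of facts, so that the quotient can be listed as a database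
    although [P] may be infinite. *)
Lemma fact_shape F p l : fact F p l ->
  exists s (mu : var -> node),
    In (p, s) (D ++ flat_map (@head P) T) /\ l = List.map mu s.
Proof.
case=> [p' l' plD|k i a _ ah].
  by exists l', cst; split=> //; apply/in_or_app; left.
exists (snd a), (skolem k i); split=> //; apply/in_or_app; right.
apply/in_flat_map; exists (rule_of i); split; last by case: a ah.
by apply: nth_In; apply/ltP.
Qed.

End SkolemForest.

Lemma finite_relation_list (P : Type) (C : finType) (R : P -> list C -> Prop)
    (shapes : list (atom P var)) :
  (forall p l, R p l -> exists s (mu : var -> C),
    In (p, s) shapes /\ l = List.map mu s) ->
  exists E : list (atom P C), forall p l, In (p, l) E <-> R p l.
Proof.
move=> Rshape.
pose words n : list (list C) := List.map val (enum {: n.-tuple C}).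
have wordsP l : In l (words (length l)).
  apply/in_map_iff; exists (in_tuple l); split=> //.
  by apply/In_mem; rewrite mem_enum.
exists (List.filter (fun a => `[< R a.1 a.2 >])
  (flat_map (fun s => List.map (pair s.1) (words (length s.2))) shapes)) => p l.
split=> [/filter_In [_ /asboolP //]|Rpl].
apply/filter_In; split; last exact/asboolP.
have [s [mu [ps lE]]] := Rshape _ _ Rpl.
apply/in_flat_map; exists (p, s); split=> //=; apply/in_map.
by rewrite -(length_map mu) -lE.
Qed.

(** * Closure under the datalog rules *)

Section DatalogSaturation.
Variables (P : Type) (T : theory P) (M : structure P).

Inductive derivable : P -> list (dom M) -> Prop :=
| derivable_fact p l : rel M p l -> derivable p l
| derivable_rule r a (nu : var -> dom M) : In r T -> datalog_rule r ->
    In a (head r) ->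
    (forall b, In b (body r) -> derivable (fst b) (List.map nu (snd b))) ->
    derivable (fst a) (List.map nu (snd a)).

Definition saturation : structure P :=
  {| dom := dom M; elt := elt M; rel := derivable |}.

Lemma datalog_head (r : rule P) a v :
  datalog_rule r -> In a (head r) -> In v (snd a) -> In v (vars (body r)).
Proof. by move=> [b [-> rv]] [<-|//] /rv. Qed.

(** Datalog heads use body variables only, so the witness [nu'] found in [N] agrees with [f] on
    them. *)
Lemma derivable_hom (N : structure P) (f : dom M -> dom N) :
  model_theory N T -> (forall p l, rel M p l -> rel N p (List.map f l)) ->
  forall p l, derivable p l -> rel N p (List.map f l).
Proof.
move=> NT fhom p l; elim=> [{}p {}l /fhom //|r a nu rT rd ah _ IH].
have [|nu' [nuE nu'P]] := NT r rT (fun v => f (nu v)).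
  by move=> b br; rewrite /holds -List.map_map; apply: IH.
have := nu'P a ah; rewrite /holds List.map_map.
rewrite (List.map_ext_in nu' (fun v => f (nu v))) //.
by move=> v va; apply/nuE/(datalog_head rd ah va).
Qed.

(** Used to lift an element met by a rule body to a live node of the forest. *)
Lemma derivable_elt p l x : derivable p l -> In x l ->
  exists p' l', rel M p' l' /\ In x l'.
Proof.
move=> pl; elim: pl x => [{}p {}l pl|r a nu rT rd ah _ IH] x.
  by exists p, l.
move=> /in_map_iff [v [<- va]].
have /in_flat_map [b [br vb]] := datalog_head rd ah va.
by apply: (IH b br); apply: in_map.
Qed.

Lemma saturation_datalog (r : rule P) :
  In r T -> datalog_rule r -> sat_rule saturation r.
Proof.
move=> rT rd nu nuP; exists nu; split=> // a ah.
exact: derivable_rule rT rd ah nuP.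
Qed.

End DatalogSaturation.

Lemma single_head (P : Type) (T : theory P) :
  (forall r, In r T -> datalog_rule r \/ single_frontier_atom_tgd r) ->
  forall i : index T, exists a, head (rule_of i) = [:: a].
Proof.
move=> Trules i; have := Trules (rule_of i).
by case=> [|[a [? _]]|[a [y [? _]]]]; [apply/nth_In/ltP|exists a..].
Qed.

(** * The finite countermodel *)

Section Fold.
Variables (P : Type) (arity : P -> nat) (T : theory P) (D : database P).
Variables (B V K : nat) (q : cq P) (Q : ucq P) (F : set (trigger T B V)).

Hypothesis Twf : wf_theory arity T.
Hypothesis Trules :
  forall r, In r T -> datalog_rule r \/ single_frontier_atom_tgd r.
Hypothesis Dwf : wf_db arity D.
Hypothesis DB : forall c, In c (adom D) -> c < B.+1.
Hypothesis TV :
  forall v, In v (flat_map (fun r => vars (head r)) T) -> v < V.+1.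
Hypothesis QK : forall q', In q' Q -> length (vars q') <= K.
Hypothesis Qwf : forall q', In q' Q -> wf_cq arity q'.
Hypothesis Qrew :
  forall E, wf_db arity E -> entails T E q <-> sat_ucq (db_structure E) Q.
Hypothesis Fcl : closed F.
Hypothesis FQ : ~ sat_ucq (forest D F) Q.
Hypothesis Fmax : forall G, F `<` G -> closed G -> sat_ucq (forest D G) Q.

Let quot := quotient D K F.
Let cls := class_of K F.

Lemma fact_wf p l : fact D F p l -> length l = arity p.
Proof.
case=> [p' l' /Dwf <-|k i a _ ah]; rewrite length_map //.
have iT : In (rule_of i) T by apply/nth_In/ltP.
exact: (proj2 (Twf iT)).
Qed.

(** The model [N] serves twice: to show by maximality that the required triggers fire, and to refute
    [q] in the closure. *)
Lemma quotient_countermodel : exists N : structure P,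
  [/\ model_theory N T, ~ sat_cq N q & exists f : dom quot -> dom N,
      forall p l, rel quot p l -> rel N p (List.map f l)].
Proof.
have [|E0 E0P] := @finite_relation_list _ _ (rel quot)
    (D ++ flat_map (@head P) T).
  move=> p l [l' pl' ->]; have [s [mu [ps ->]]] := fact_shape pl'.
  by exists s, (fun v => cls (mu v)); rewrite List.map_map.
(* Database constants are natural numbers, so classes are numbered; [decode] carries a match of [Q]
   back to the quotient. *)
pose code (c : class T B V K) : const := enum_rank c.
pose decode (n : const) : class T B V K :=
  xget (cls (cst T B V 0)) [set c | code c = n].
have codeK c : decode (code c) = c.
  apply/enum_rank_inj/val_inj.
  by apply: (@xgetPex _ _ [set d | code d = code c]); exists c.
pose E : database P := List.map (fun a => (a.1, List.map code a.2)) E0.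
have EP p l : rel quot p l -> In (p, List.map code l) E.
  by move=> /E0P pl; apply/in_map_iff; exists (p, l).
have Ewf : wf_db arity E.
  move=> f /in_map_iff [[p l] [<- /E0P [l' /fact_wf pl' ->]]].
  by rewrite /wf_atom /= !length_map.
have EQ : ~ entails T E q.
  move=> /Qrew -/(_ Ewf) EQ; apply: FQ.
  apply: (quotient_conservative (K := K)) => //; first exact: single_head.
  apply: sat_ucq_hom EQ => p l /in_map_iff [[p' l'] [[<- <-] /E0P pl']].
  by rewrite List.map_map (List.map_ext _ id) ?List.map_id.
have /existsNP [N /not_implyP [[h [_ hE]] /not_implyP [NT Nq]]] := EQ.
exists N; split=> //; exists (fun c => h (code c)) => p l /EP /hE /=.
by rewrite List.map_map.
Qed.

(* Firing [i] at an unfired [u] produces a disjunct of [Q], by maximality; that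
   firing is realised in [N] because [N] contains the quotient and satisfies
   the body of [i] at the class of [u]. *)
Lemma fires_of_body (N : structure P) (f : dom quot -> dom N) k i
    (nu : var -> dom quot) :
  model_theory N T -> ~ sat_cq N q ->
  (forall p l, rel quot p l -> rel N p (List.map f l)) ->
  isSome k = isSome (frontier i) ->
  (if k is Some x then alive F x else True) ->
  (forall x y, k = Some x -> frontier i = Some y -> nu y = cls x) ->
  (forall a, In a (body (rule_of i)) ->
     holds (M := saturation T quot) nu a) ->
  F (k, i).
Proof.
move=> NT Nq fhom ki kF nuk nuP; apply: contrapT => Fki; apply: Nq.
have iT : In (rule_of i) T by apply/nth_In/ltP.
have [|nu' [nuE nu'P]] := NT _ iT (fun v => f (nu v)).
  move=> a /nuP aq; rewrite /holds -List.map_map.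
  exact: derivable_hom NT fhom _ _ aq.
have FF : F `<` (F `|` [set (k, i)]).
  by split=> [|sub]; [exact: subsetUl|apply/Fki/sub; right].
have [q' [q'Q q'F]] := Fmax FF (closed_setU1 Fcl ki kF).
apply: (rewriting_sound Qwf (fun E Ewf => proj2 (Qrew Ewf)) NT).
exists q'; split=> //.
(* Nodes created by the new trigger go to the witnesses in [N]. Nodes alive in [F] have another
   origin and keep their image through the quotient. *)
pose theta x := if origin x == Some (k, i) then nu' (last_var x) else f (cls x).
have thetaF x : alive F x -> theta x = f (cls x).
  by rewrite /theta; case: eqP => // ox; rewrite /alive ox.
apply: (sat_cq_hom (M := forest D _) (f := theta)) q'F
  => p l [p' l' plD|k' j a Fkj ah].
  rewrite (List.map_ext_in _ (fun x => f (cls x))) //.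
    rewrite -List.map_map; apply: fhom; eexists; last by [].
    exact: fact_db.
  by move=> x /in_map_iff [c [<- _]]; apply: thetaF.
case: Fkj => [Fkj|[k'E jE]].
  rewrite (List.map_ext_in _ (fun x => f (cls x))) //.
    rewrite -List.map_map; apply: fhom; eexists; last by [].
    exact: fact_fire ah.
  by move=> x /in_map_iff [v [<- _]]; apply/thetaF/alive_skolem.
rewrite {}k'E {}jE in ah *.
rewrite List.map_map (List.map_ext_in _ nu'); first exact: nu'P.
move=> v va; have vh : In v (vars (head (rule_of i))) by apply: In_vars va.
have [fv|/eqP fv] := eqVneq (frontier i) (Some v).
  have [x kx] : exists x, k = Some x.
    by case: (k) ki => [x _|]; [exists x|rewrite fv].
  rewrite kx skolem_frontier // thetaF; last by rewrite kx in kF.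
  by rewrite -(nuk x v) // nuE //; have [] := frontier_Some fv.
rewrite /theta skolem_origin // eqxx skolem_last_var //.
by apply: TV; apply/in_flat_map; exists (rule_of i).
Qed.

Lemma saturation_model : model_theory (saturation T quot) T.
Proof.
have [N [NT Nq [f fhom]]] := quotient_countermodel.
move=> r rT; have [/saturation_datalog|rt] := Trules rT; first exact.
have [n [/ltP nT rE]] := In_nth T r (Rule nil nil) rT.
pose i : index T := Ordinal nT; rewrite -{}rE -/(rule_of i) in rt *.
move=> nu nuP.
(* The frontier variable occurs in the body, so its value is the class of a live node, where the
   rule is to be fired. *)
have [k [ki kF nuk]] : exists k, [/\ isSome k = isSome (frontier i),
    (if k is Some x then alive F x else True) &
    forall x y, k = Some x -> frontier i = Some y -> nu y = cls x].
  case fi: (frontier i) => [y|]; last by exists None.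
  have [/in_flat_map [a [ab ya]] _] := frontier_Some fi.
  have [p [l [[l' pl' ->] /in_map_iff [x [xy xl']]]]] :=
    derivable_elt (nuP a ab) (in_map nu _ _ ya).
  exists (Some x); split=> //; first exact: fact_alive pl' xl'.
  by move=> _ _ [<-] [<-].
have Fki := fires_of_body NT Nq fhom ki kF nuk nuP.
exists (fun v => if v \in vars (body (rule_of i)) then nu v
                 else cls (skolem k i v)).
split=> [v /In_mem -> //|a ah]; apply: derivable_fact.
exists (List.map (skolem k i) (snd a)); first exact: fact_fire.
rewrite List.map_map; apply: List.map_ext_in => v va.
case: ifP => // /In_mem vb.
have vh : In v (vars (head (rule_of i))) by apply: In_vars va.
case fi: (frontier i) ki => [y|]; last by have := frontier_None fi vh.
case: k kF nuk Fki => // x _ nuk _ _.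
have [yb yh] := frontier_Some fi.
(* A head variable also occurring in the body must be the frontier variable, as an existential rule
   has only one. *)
suff vy : v = y by rewrite skolem_frontier ?vy // (nuk x y).
have [b [z [hb zP]]] := rt.
have inb w : In w (vars (head (rule_of i))) -> In w (snd b).
  by rewrite hb /vars /= app_nil_r.
by transitivity z; [|symmetry]; apply: zP => //; apply: inb.
Qed.

Lemma finite_countermodel : exists M : structure P,
  finite_structure M /\ model_db M D /\ model_theory M T /\ ~ sat_cq M q.
Proof.
exists (saturation T quot); split; [|split; [|split]].
- by exists (enum {: class T B V K}) => c; apply/In_mem; rewrite mem_enum.
- exists (fun c => cls (cst T B V c)); split.
    move=> c d /DB cB /DB dB /class_of_cst [] /(congr1 val).
    by rewrite /= !inordK.
  move=> [p l] plD; apply: derivable_fact.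
  by exists (List.map (cst T B V) l); [exact: fact_db|rewrite List.map_map].
- exact: saturation_model.
- have [N [NT Nq [f fhom]]] := quotient_countermodel.
  apply: contra_not Nq; apply: (sat_cq_hom (M := saturation T quot)).
  exact: derivable_hom NT fhom.
Qed.

End Fold.

Theorem theorem16 (P : Type) (arity : P -> nat) (T : theory P) :
  wf_theory arity T ->
  (forall r, In r T -> datalog_rule r \/ single_frontier_atom_tgd r) ->
  BDD arity T -> FC arity T.
Proof.
move=> Twf Trules Tbdd D q Dwf qwf Dq.
have [Q [Qwf Qrew]] := Tbdd q qwf.
(* [B] and [V] make the alphabet of Skolem terms finite, hence also [class]. *)
have [B DB] := list_upper_bound (adom D).
have [V TV] := list_upper_bound (flat_map (fun r => vars (head r)) T).
have [K QK] := list_upper_bound (List.map (fun q' => length (vars q')) Q).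
have [F [Fcl FQ Fmax]] := @maximal_forest _ T _ B V Q DB
  (contra_not (proj2 (Qrew D Dwf)) Dq).
have QK' q' : In q' Q -> length (vars q') <= K.
  by move=> q'Q; rewrite -ltnS; apply: QK; apply: in_map q'Q.
exact: finite_countermodel Twf Trules Dwf DB TV QK' Qwf Qrew Fcl FQ Fmax.
Qed.
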